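(* If $D$ is a hook diagram, then $\mathcal{P}(D)$ is EL-shellable.
   Context: A diagram is a finite set of cells in $\mathbb{Z}_{>0}\times\mathbb{Z}_{>0}$; a cell $(r,c)$ lies in row $r$ (rows numbered from the bottom, starting at $1$) and column $c$. Applying a Kohnert move at row $r$ of a diagram $D$: if row $r$ is nonempty, let $(r,c)$ be its rightmost cell; if there is $r'$ with $1\le r'<r$ and $(r',c)\notin D$, take the largest such $r'$ and replace $(r,c)$ by $(r',c)$; otherwise $D$ is unchanged. $KD(D)$ is the set of diagrams obtainable from $D$ by finite (possibly empty) sequences of Kohnert moves; the Kohnert poset $\mathcal{P}(D)$ is $KD(D)$ with $D_2\preceq D_1$ iff $D_2$ can be obtained from $D_1$ by Kohnert moves. For positive integers $r_1\le r_2$ and a finite nonempty $C=\{c_1,\dots,c_m\}\subset\mathbb{Z}_{>0}$ with $c_m=\max C$, $H(r_1,r_2;C)=\{(r_2,c_i)\mid 1\le i\le m\}\cup\{(j,c_m)\mid r_1\le j\le r_2\}$. A hook diagram is a diagram lying in $KD(H(r_1,r_2;C))$ for some such $r_1,r_2,C$. A bounded poset (unique minimum and maximum) is EL-shellable if its covering pairs admit a labeling $\lambda$ by elements of some poset such that every interval $[x,y]$ has a unique saturated chain from $x$ to $y$ with weakly increasing labels, and its label sequence is lexicographically smaller than that of every other saturated chain from $x$ to $y$. *)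

(* Defs.v *)
From HB Require Import structures.
From mathcomp Require Import all_boot all_order finmap.
From mathcomp Require Import boolp.

Set Implicit Arguments.
Unset Strict Implicit.
Unset Printing Implicit Defensive.

Import Order.TTheory.

Local Open Scope fset_scope.

(* A cell is a pair (row, column). [cells] allows the index 0; the requirement
   that rows and columns be positive is [is_diagram]. *)
Definition cells := {fset nat * nat}.

Definition is_diagram (D : cells) : Prop :=
  forall x, x \in D -> (0 < x.1) && (0 < x.2).

Definition row (D : cells) (r : nat) : cells := [fset x in D | x.1 == r].

Definition rightmost (D : cells) (r : nat) : nat := \max_(x <- row D r) x.2.

(* The largest r' with 1 <= r' < r and (r', c) \notin D, and 0 if there is
   none. *)
Definition landing_row (D : cells) (r c : nat) : nat :=
  \max_(1 <= r' < r | (r', c) \notin D) r'.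

Definition kohnert_move (D : cells) (r : nat) : cells :=
  let c := rightmost D r in
  let r' := landing_row D r c in
  if (row D r != fset0) && (0 < r') then (r', c) |` (D `\ (r, c)) else D.

(* s lists the rows at which the moves are applied, first move first. *)
Definition kohnert_le (D2 D1 : cells) : Prop :=
  exists s : seq nat, D2 = foldl kohnert_move D1 s.

Definition KD (D E : cells) : Prop := kohnert_le E D.

Definition hook (r1 r2 : nat) (C : {fset nat}) : cells :=
  [fset (r2, c) | c in C] `|`
  [fset (j, \max_(c <- C) c) | j in index_iota r1 r2.+1].

Definition hook_diagram (D : cells) : Prop :=
  is_diagram D /\
  exists (r1 r2 : nat) (C : {fset nat}),
    [/\ 0 < r1, r1 <= r2, C != fset0, (forall c, c \in C -> 0 < c)
      & KD (hook r1 r2 C) D].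

Lemma bigmax_attained (s : seq (nat * nat)) :
  s != [::] -> exists2 x, x \in s & \max_(y <- s) y.2 = x.2.
Proof.
elim: s => // x s IH _; rewrite big_cons.
have [->|/IH[y ys ->]] := eqVneq s [::].
  by exists x; rewrite ?inE // big_nil maxn0.
case: (leqP x.2 y.2) => _; last by exists x; rewrite ?inE ?eqxx.
by exists y; rewrite // inE ys orbT.
Qed.

Lemma rightmost_in (D : cells) r :
  row D r != fset0 -> (r, rightmost D r) \in D.
Proof.
move=> rn0.
suff: exists2 x, x \in row D r & rightmost D r = x.2.
  by case=> -[a b]; rewrite !inE /= => /andP[abD /eqP<-] ->.
rewrite /rightmost; have /bigmax_attained: enum_fset (row D r) != [::].
  by rewrite -size_eq0 cardfs_eq0.
by case=> x xD ->; exists x.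
Qed.

Lemma landing_rowP (D : cells) r c : 0 < landing_row D r c ->
  landing_row D r c < r /\ (landing_row D r c, c) \notin D.
Proof.
rewrite /landing_row => gt0.
suff: let m := \max_(1 <= r' < r | (r', c) \notin D) r' in
      (m == 0) || (m < r) && ((m, c) \notin D).
  by move=> /=; rewrite eqn0Ngt gt0 => /andP.
rewrite big_nat_cond; elim/big_ind: _ => //= [x y Hx Hy|i].
  by case: (leqP x y).
by move=> /andP[/andP[_ ->] ->]; rewrite orbT.
Qed.

Definition weight (D : cells) : nat := \sum_(x <- D) x.1.

Lemma weight_move D r :
  kohnert_move D r = D \/ weight (kohnert_move D r) < weight D.
Proof.
rewrite /kohnert_move; case: ifP => [/andP[/rightmost_in rD]|]; last by left.
move=> /landing_rowP; set r' := landing_row _ _ _ => -[lt_r' r'D].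
right; rewrite /weight big_fsetU1; last by rewrite !inE negb_and r'D orbT.
by rewrite [ltnRHS](big_fsetD1 _ rD) /= ltn_add2r.
Qed.

Lemma weight_le D2 D1 : kohnert_le D2 D1 -> D2 = D1 \/ weight D2 < weight D1.
Proof.
case=> s ->; elim: s D1 => [|r s IH] D1 /=; first by left.
case: (weight_move D1 r) => [->|lt1]; first exact: IH.
by right; case: (IH (kohnert_move D1 r)) => [->|/ltn_trans->].
Qed.

Lemma kohnert_le_refl D : kohnert_le D D.
Proof. by exists [::]. Qed.

Lemma kohnert_le_trans D2 D1 D3 :
  kohnert_le D1 D2 -> kohnert_le D2 D3 -> kohnert_le D1 D3.
Proof. by case=> s -> [t ->]; exists (t ++ s); rewrite foldl_cat. Qed.

Lemma kohnert_le_anti D1 D2 : kohnert_le D1 D2 -> kohnert_le D2 D1 -> D1 = D2.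
Proof.
move=> /weight_le[-> //|lt12] /weight_le[-> //|].
by rewrite ltnNge ltnW.
Qed.

Definition kohnert_poset (D : cells) : Type := {E : cells | `[< KD D E >]}.

HB.instance Definition _ (D : cells) := SubChoice.on (kohnert_poset D).

Fact kohnert_display : Order.disp_t. Proof. exact: Order.Disp tt tt. Qed.

Section KohnertPoset.
Variable D : cells.

Definition kohnert_leb : rel (kohnert_poset D) :=
  fun E2 E1 => `[< kohnert_le (val E2) (val E1) >].

Fact kohnert_leb_refl : reflexive kohnert_leb.
Proof. by move=> E; apply/asboolP/kohnert_le_refl. Qed.

Fact kohnert_leb_anti : antisymmetric kohnert_leb.
Proof.
by move=> E F /andP[/asboolP h /asboolP k]; apply/val_inj/kohnert_le_anti.
Qed.

Fact kohnert_leb_trans : transitive kohnert_leb.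
Proof.
by move=> F E G /asboolP h /asboolP k; apply/asboolP/(kohnert_le_trans h k).
Qed.

HB.instance Definition _ := Order.Le_isPOrder.Build kohnert_display
  (kohnert_poset D) kohnert_leb_refl kohnert_leb_anti kohnert_leb_trans.

End KohnertPoset.

Section ELShellable.
Variables (d : Order.disp_t) (T : porderType d).
Local Open Scope order_scope.

Definition bounded_poset : Prop :=
  exists bot top : T, forall x, bot <= x <= top.

Definition covers : rel T :=
  fun x y => (x < y) && `[< forall z, ~~ (x < z < y) >].

(* The saturated chain x = x_0 < x_1 < ... < x_k = y is represented by
   [:: x_1; ...; x_k]. *)
Definition saturated_chain (x y : T) (s : seq T) : bool :=
  path covers x s && (last x s == y).

Section Labeling.
Variables (d' : Order.disp_t) (L : porderType d').

(* Only the values of lam on covering pairs are ever used. *)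
Variable lam : T -> T -> L.

Definition chain_labels (x : T) (s : seq T) : seqlexi L := pairmap lam x s.

Definition increasing_chain (x : T) (s : seq T) : bool :=
  sorted <=%O (chain_labels x s).

Definition EL_labeling : Prop :=
  forall x y : T, x <= y -> exists s : seq T,
    [/\ saturated_chain x y s,
        increasing_chain x s,
        forall t, saturated_chain x y t -> increasing_chain x t -> t = s
      & forall t, saturated_chain x y t -> t <> s ->
          chain_labels x s < chain_labels x t].

End Labeling.

Definition EL_shellable : Prop :=
  bounded_poset /\
  exists (d' : Order.disp_t) (L : porderType d') (lam : T -> T -> L),
    EL_labeling lam.

End ELShellable.

Arguments EL_shellable {d} T.

(* Main.v *)
Require Import Defs.
From mathcomp Require Import all_boot all_order finmap boolp zify.

Set Implicit Arguments.
Unset Strict Implicit.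
Unset Printing Implicit Defensive.

Import Order.TTheory.

(** A hook diagram has an arm cell in each of the columns c_1 < ... < c_k and
    n cells in the column c_m.  Listing the rows of the arm cells by increasing
    column and then those of the last column from top to bottom gives
    coordinates x_0 >= ... >= x_{k-1} >= x_k > ... > x_{k+n-1} >= 1: an arm cell
    moves only when it is the rightmost cell of its row, so it never passes below
    an arm cell to its right or below the top cell of the last column.  Jumps in the last column are
    compositions of one-step moves, so the Kohnert order is the componentwise
    order on such sequences, and [x] is covered by [y] iff they differ by one in
    exactly one coordinate.  Labelling a cover by the index of that coordinate
    is an EL-labeling: the increasing chain from [x] to [y] raises the
    coordinates to their final values one after the other. *)

(** * EL-labelings of posets ordered by coordinates *)

Section Coordinates.
Local Open Scope order_scope.
Variables (d : Order.disp_t) (T : porderType d) (N : nat) (f : T -> nat -> nat).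

Hypothesis le_coord :
  forall x y : T, x <= y <-> forall i, (i < N)%N -> (f x i <= f y i)%N.
(** Raising a later gap could break a constraint against an earlier coordinate, so only the first
    gap is assumed raisable. *)
Hypothesis raise_coord : forall (x y : T) i, x <= y -> (i < N)%N ->
  (f x i < f y i)%N -> (forall j, (j < i)%N -> f x j = f y j) ->
  exists z : T, forall j, (j < N)%N -> f z j = (f x j + (j == i))%N.

(** On a cover only one coordinate grows, and [find] returns its index. *)
Let lam (x y : T) : nat := find (fun i => f x i < f y i)%N (iota 0 N).

Let eq_coord (x y : T) : (forall i, (i < N)%N -> f x i = f y i) -> x = y.
Proof. by move=> e; apply/le_anti/andP; split; apply/le_coord => i /e ->. Qed.

Let lt_coord (x y : T) : x < y -> exists i, [/\ (i < N)%N, (f x i < f y i)%N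
  & forall j, (j < i)%N -> f x j = f y j].
Proof.
move=> xy; have xyw := ltW xy.
have hex : exists i, (i < N)%N && (f x i < f y i)%N.
  apply: contrapT => h; move: xy; rewrite lt_neqAle => /andP[/eqP nxy _].
  apply: nxy; apply: eq_coord => i iN; apply/eqP; rewrite eqn_leq (le_coord x y).1 //=.
  by rewrite leqNgt; apply/negP => lti; apply: h; exists i; rewrite iN.
case: (ex_minnP hex) => i /andP[iN lti] mini; exists i; split=> // j ji.
have jN : (j < N)%N by lia.
have := (le_coord x y).1 xyw j jN; have := mini j; rewrite jN /=; lia.
Qed.

(** Raising the first gap of [x] gives some [z] with [x < z <= y], which a cover forces to be
    [y]. *)
Let coversP (x y : T) : covers x y -> exists i, (i < N)%N /\
  forall j, (j < N)%N -> f y j = (f x j + (j == i))%N.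
Proof.
move=> /andP[xy /asboolP nb]; have [i [iN lti eqi]] := lt_coord xy.
have [z hz] := raise_coord (ltW xy) iN lti eqi; exists i; split=> //.
suff -> : y = z by [].
apply/eqP; apply: contraT => yz; have /negP[] := nb z; apply/andP; split.
  rewrite lt_neqAle; apply/andP; split.
    by apply/eqP => xz; have := hz i iN; rewrite xz eqxx; lia.
  by apply/le_coord => j jN; rewrite hz // leq_addr.
rewrite lt_neqAle eq_sym yz; apply/le_coord => j jN; rewrite hz //.
have := (le_coord x y).1 (ltW xy) j jN; have [->|] := eqVneq j i; lia.
Qed.

Let covers_raise (x y : T) i : (i < N)%N ->
  (forall j, (j < N)%N -> f y j = (f x j + (j == i))%N) -> covers x y.
Proof.
move=> iN hy; have lexy : x <= y.
  by apply/le_coord => j jN; rewrite hy // leq_addr.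
apply/andP; split.
  rewrite lt_neqAle lexy andbT; apply/eqP => xy.
  by have := hy i iN; rewrite xy eqxx; lia.
apply/asboolP => z; apply/negP => /andP[xz zy].
have [a [aN lta _]] := lt_coord xz; have [b [bN ltb _]] := lt_coord zy.
have ha := (le_coord z y).1 (ltW zy) a aN.
have hb := (le_coord x z).1 (ltW xz) b bN.
move: (hy a aN) (hy b bN); have [ea|] := eqVneq a i; last lia.
have [eb|] := eqVneq b i; last lia.
by move: lta ltb ha hb; rewrite ea eb; lia.
Qed.

Let lam_raise (x y : T) i : (i < N)%N ->
  (forall j, (j < N)%N -> f y j = (f x j + (j == i))%N) -> lam x y = i.
Proof.
move=> iN hy; rewrite /lam.
have hs : has (fun j => f x j < f y j)%N (iota 0 N).
  apply/hasP; exists i; first by rewrite mem_iota.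
  by rewrite hy // eqxx addn1.
have h1 := nth_find 0 hs; move: hs; rewrite has_find size_iota => h2.
rewrite nth_iota // add0n in h1; move: h1; rewrite hy //.
by case: eqP => // _; lia.
Qed.

Let chain_le (x y : T) s : saturated_chain x y s -> x <= y.
Proof.
case/andP; elim: s x => [|z s IH] x /=; first by move=> _ /eqP ->.
move=> /andP[/andP[xz _] ps] ls; exact: le_trans (ltW xz) (IH z ps ls).
Qed.

(** A saturated chain raises coordinates in unit steps and never lowers one, so its set of labels
    depends only on its ends. *)
Let mem_labels (x y : T) s i : saturated_chain x y s ->
  (i \in (chain_labels lam x s : seq nat)) = ((i < N)%N && (f x i < f y i)%N).
Proof.
elim: s x => [|z s IH] x.
  by case/andP=> _ /eqP /= ->; rewrite ltnn andbF.
case/andP=> /= /andP[cz ps] ls.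
have sc : saturated_chain z y s by apply/andP.
have [a [aN hz]] := coversP cz; rewrite inE (lam_raise aN hz).
have -> := IH z sc; have [->|ne] /= := eqVneq i a.
  have := (le_coord z y).1 (chain_le sc) a aN; rewrite hz // eqxx aN; lia.
by case: ltnP => // iN; rewrite hz // (negPf ne) addn0.
Qed.

Lemma EL_labeling_coord : EL_labeling lam.
Proof.
move=> x y.
have [m] := ubnP (\sum_(i < N) (f y i - f x i)).
elim: m x => // m IH x hm lexy.
have [exy|nexy] := eqVneq x y.
  have nilt t : saturated_chain x y t -> t = [::].
    case: t => [|z t] // /andP[/= /andP[/andP[xz _] pt] lt].
    have zy : z <= y by apply: (@chain_le _ _ t); apply/andP.
    by move: (lt_le_trans xz zy); rewrite exy ltxx.
  exists [::]; split=> //; first by rewrite /saturated_chain /= exy.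
    by move=> t /nilt.
  by move=> t /nilt.
have ltxy : x < y by rewrite lt_neqAle nexy.
have [i [iN lti eqi]] := lt_coord ltxy.
(* The increasing chain starts by raising the first gap [i]; the rest comes from induction on the
   total gap. *)
have [z hz] := raise_coord lexy iN lti eqi.
have lezy : z <= y.
  apply/le_coord => j jN; rewrite hz //.
  have := (le_coord x y).1 lexy j jN; have [->|] := eqVneq j i; lia.
have ltm : (\sum_(j < N) (f y j - f z j) < m)%N.
  rewrite ltnS in hm; apply: leq_trans hm.
  rewrite (bigD1 (Ordinal iN)) //= [ltnRHS](bigD1 (Ordinal iN)) //=.
  rewrite hz // eqxx -addSn; apply: leq_add; first lia.
  by apply: leq_sum => j _; rewrite hz //; lia.
have [s [sat inc uni lex]] := IH z ltm lezy.
have cxz : covers x z := covers_raise iN hz.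
have lxz := lam_raise iN hz.
(* No coordinate before [i] ever moves, so a first label other than [i] is larger. *)
have first_label w t : saturated_chain x y (w :: t) ->
    (i < lam x w)%N \/ w = z.
  move=> sc; have := mem_labels (lam x w) sc; rewrite inE eqxx /=.
  move=> /esym/andP[aN lta].
  case/andP: sc => /= /andP[cw _] _; have [a [aN' hw]] := coversP cw.
  have la := lam_raise aN' hw; rewrite la in lta *.
  case: (ltngtP i a) => [|ai|ia]; first by left.
    by move: lta; rewrite eqi ?ltnn.
  by right; apply: eq_coord => j jN; rewrite hw // hz // ia.
have tail w t : saturated_chain x y (w :: t) -> saturated_chain w y t.
  by case/andP => /= /andP[_ h1] h2; apply/andP.
(* The label [i] must still occur, and after a larger label it breaks monotonicity. *)
have ge_label w t : saturated_chain x y (w :: t) ->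
    (i < lam x w)%N -> increasing_chain lam x (w :: t) -> False.
  move=> sc lt inct; have := mem_labels i sc; rewrite iN lti inE /=.
  move=> /orP[/eqP e|mi]; first by move: lt; rewrite -e ltnn.
  move: inct; rewrite /increasing_chain /=.
  rewrite (path_sortedE (@le_trans _ _)) => /andP[/allP/(_ i mi)].
  by rewrite leEnat leqNgt lt.
exists (z :: s); split.
- by case/andP: sat => ps ls; rewrite /saturated_chain /= cxz ps.
- rewrite /increasing_chain /= (path_sortedE (@le_trans _ _)).
  apply/andP; split; last exact: inc.
  apply/allP => j; rewrite (mem_labels j sat) => /andP[jN ltj].
  rewrite lxz leEnat leqNgt; apply/negP => ji.
  by move: ltj; rewrite hz // eqi // (ltn_eqF ji) addn0 ltnn.
- case=> [|w t] sc inct.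
    by case/andP: sc => _ /eqP /= exy; rewrite exy eqxx in nexy.
  case: (first_label w t sc) => [lt|ew]; first by case: (ge_label w t sc lt inct).
  rewrite ew in sc inct *; congr (_ :: _); apply: uni; first exact: tail sc.
  by move: inct; rewrite /increasing_chain /= => /path_sorted.
- case=> [|w t] sc ne.
    by case/andP: sc => _ /eqP /= exy; rewrite exy eqxx in nexy.
  rewrite /chain_labels /= ltxi_cons lxz leEnat.
  case: (first_label w t sc) => [lt|ew]; first by rewrite ltnW // leqNgt lt.
  rewrite ew in sc ne *; rewrite lxz leqnn /=.
  by apply: lex; [exact: tail sc|move=> e; apply: ne; rewrite e].
Qed.

End Coordinates.

Local Open Scope fset_scope.
Local Open Scope nat_scope.

Lemma le_landing_row (D : cells) r c m :
  0 < m -> m < r -> (m, c) \notin D -> m <= landing_row D r c.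
Proof.
move=> m0 mr mD; rewrite /landing_row.
by apply: (@leq_bigmax_seq _ (index_iota 1 r) (fun i => (i, c) \notin D) id);
   rewrite // mem_index_iota m0.
Qed.

(** * Coordinates of hook diagrams *)

Section HookCoordinates.
Variables (k n : nat) (col : nat -> nat).
Hypothesis col_lt : forall i j, i < j -> j <= k -> col i < col j.
Hypothesis col_last : forall i, k <= i -> col i = col k.

Let N := k + n.

(** The boolean [k <= i], read as 0 or 1, makes the sequence strictly decreasing from index [k] on,
    inside the last column, and weakly decreasing before. *)
Definition hook_coords (x : nat -> nat) : Prop :=
  (forall i j, i < j -> j < N -> x j + (k <= i) <= x i) /\
  (forall i, i < N -> 0 < x i).

Definition coord_diagram (x : nat -> nat) : cells :=
  [fset (x i, col i) | i in iota 0 N].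

Lemma coord_diagramP x p :
  reflect (exists2 i, i < N & p = (x i, col i)) (p \in coord_diagram x).
Proof.
apply: (iffP (imfsetP _ _ _ _)) => /= -[i h ->]; exists i => //.
  by move: h; rewrite mem_iota.
by rewrite mem_iota.
Qed.

Lemma mem_coord_diagram x i : i < N -> (x i, col i) \in coord_diagram x.
Proof. by move=> iN; apply/coord_diagramP; exists i. Qed.

Lemma eq_coord_diagram x y :
  (forall i, i < N -> x i = y i) -> coord_diagram x = coord_diagram y.
Proof.
move=> e; apply/fsetP => p; apply/coord_diagramP/coord_diagramP => -[i iN ->];
  by exists i; rewrite // e.
Qed.

Let col_le i j : i <= j -> col i <= col j.
Proof.
move=> ij; have [jk|kj] := leqP j k.
  by move: ij; rewrite leq_eqVlt => /orP[/eqP->//|/col_lt/(_ jk)/ltnW].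
rewrite (col_last (ltnW kj)); have [ki|ik] := leqP k i; first by rewrite col_last.
exact: ltnW (col_lt ik (leqnn k)).
Qed.

Let col_eq i j : col i = col j -> i = j \/ (k <= i /\ k <= j).
Proof.
move=> e; have [ki|ik] := leqP k i; have [kj|jk] := leqP k j; try by right.
- by have := col_lt jk (leqnn k); rewrite -e col_last // ltnn.
- by have := col_lt ik (leqnn k); rewrite e col_last // ltnn.
left; case: (ltngtP i j) => // lt.
  by have := col_lt lt (ltnW jk); rewrite e ltnn.
by have := col_lt lt (ltnW ik); rewrite e ltnn.
Qed.

Let cell_inj x i j : hook_coords x -> i < N -> j < N ->
  x i = x j -> col i = col j -> i = j.
Proof.
move=> [vx _] iN jN ex /col_eq[//|[ki kj]].
case: (ltngtP i j) => // lt.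
  by have := vx i j lt jN; rewrite ki; lia.
by have := vx j i lt iN; rewrite kj; lia.
Qed.

(** A strict order on cells in which valid coordinates list the diagram sorted; hence the diagram
    determines the listing. *)
Let before (p q : nat * nat) := [&& q.1 <= p.1, p.2 <= q.2 & p != q].

Let sorted_coords x : hook_coords x ->
  sorted before [seq (x i, col i) | i <- iota 0 N].
Proof.
move=> vx; rewrite sorted_map.
apply: (@sub_in_sorted _ (mem (iota 0 N)) ltn); last exact: iota_ltn_sorted.
  move=> i j; rewrite !mem_iota /= !add0n => iN jN ij.
  apply/and3P; split=> /=; first by have := vx.1 i j ij jN; lia.
    exact: col_le (ltnW ij).
  apply/eqP => -[e1 e2]; have := cell_inj vx iN jN e1 e2; lia.
by apply/allP.
Qed.

Lemma coord_diagram_inj x y : hook_coords x -> hook_coords y ->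
  coord_diagram x = coord_diagram y -> forall i, i < N -> x i = y i.
Proof.
move=> vx vy e i iN.
have : [seq (x i, col i) | i <- iota 0 N] = [seq (y i, col i) | i <- iota 0 N].
  apply: (@irr_sorted_eq _ before); rewrite ?sorted_coords //.
  - move=> [b1 b2] [a1 a2] [c1 c2]; rewrite /before !xpair_eqE /=; lia.
  - by move=> p; rewrite /before eqxx !andbF.
  - have memE z p : (p \in [seq (z i, col i) | i <- iota 0 N])
        = (p \in coord_diagram z).
      apply/mapP/coord_diagramP => -[j jN ->]; exists j => //.
        by move: jN; rewrite mem_iota.
      by rewrite mem_iota.
    by move=> p; rewrite !memE e.
move=> /(congr1 (fun s => (nth (0, 0) s i).1)).
by rewrite !(nth_map 0) ?size_iota // nth_iota.
Qed.

(* The coordinates after the cell of index [i] has landed in row [l]: the cell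
   jumps over those of index [> i] in rows above [l], which in sorted order
   amounts to lowering all of them by one. *)
Definition lower (x : nat -> nat) (i l j : nat) : nat :=
  x j - ((i <= j) && (l < x j)).

(** * One Kohnert move in coordinates *)

Section Move.
Variables (x : nat -> nat) (i : nat).
Hypothesis vx : hook_coords x.
Hypothesis iN : i < N.
(** Being the last index in its row, [i] carries the rightmost cell there. *)
Hypothesis i_last : forall j, i < j -> j < N -> x j < x i.

Let r := x i.
Let c := col i.
Let l := landing_row (coord_diagram x) r c.

Let row_neq0 : row (coord_diagram x) r != fset0.
Proof.
apply/fset0Pn; exists (r, c); rewrite !inE /= eqxx andbT.
exact: mem_coord_diagram.
Qed.

Lemma rightmost_coord_diagram : rightmost (coord_diagram x) r = c.
Proof.
apply/eqP; rewrite eqn_leq; apply/andP; split.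
  apply/bigmax_leqP_seq => -[a b]; rewrite !inE /=.
  move=> /andP[/coord_diagramP[j jN [-> ->]] /eqP e] _.
  apply: col_le; rewrite leqNgt; apply/negP => ij.
  by have := i_last ij jN; rewrite -/r e ltnn.
apply: (@leq_bigmax_seq _ _ predT snd (r, c)) => //.
by rewrite !inE /= eqxx andbT mem_coord_diagram.
Qed.

Hypothesis l_gt0 : 0 < l.

Let l_lt : l < r. Proof. by case: (landing_rowP l_gt0). Qed.

Let l_notin : (l, c) \notin coord_diagram x.
Proof. by case: (landing_rowP l_gt0). Qed.

Let between m : l < m -> m <= r -> exists j, [/\ i <= j, j < N, x j = m & col j = c].
Proof.
move=> lm; rewrite leq_eqVlt => /orP[/eqP->|mr]; first by exists i.
have : (m, c) \in coord_diagram x.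
  apply: contraT => h.
  by have := @le_landing_row _ r c m _ mr h; rewrite -/l; lia.
move=> /coord_diagramP[j jN [em ec]]; exists j; split=> //.
rewrite leqNgt; apply/negP => ji; have := vx.1 j i ji iN; move: mr.
rewrite /r em; lia.
Qed.

(** For [i < k] the column [c] holds a single cell, while a lowered index [j > i] would require a
    second one in row [x j]. *)
Let lowered_col j : i <= j -> j < N -> l < x j -> k <= i \/ j = i.
Proof.
move=> ij jN lj; have [|ik] := leqP k i; first by left.
right; apply/eqP; rewrite eqn_leq ij andbT leqNgt; apply/negP => lt.
have lr := i_last lt jN.
have [a [_ _ xa /esym/col_eq[ea|]]] := between lj (ltnW lr); last lia.
by move: lr; rewrite -xa ea ltnn.
Qed.

Lemma hook_coords_lower : hook_coords (lower x i l).
Proof.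
split=> [j1 j2 j12 j2N|j jN]; rewrite /lower; last first.
  by have := vx.2 j jN; case: (ltnP l (x j)); move: l_gt0; lia.
have h := vx.1 j1 j2 j12 j2N.
have j1N : j1 < N by lia.
have [/andP[ij1 lj1]|] /= := boolP ((i <= j1) && _); last first.
  by move: h; lia.
have -> /= : i <= j2 by lia.
have [lj2|lj2] /= := ltnP l (x j2); first by move: h; lia.
have [kj1|] /= := leqP k j1; last lia.
have ki : k <= i.
  by case: (lowered_col ij1 j1N lj1) => // <-.
(* The lowered cell may come down to row [l], so [x j2] must lie strictly below; it does, since row
   [l] is free in column [c]. *)
suff : x j2 != l by lia.
apply: contra l_notin => /eqP <-.
have -> : c = col j2 by rewrite /c !col_last //; lia.
exact: mem_coord_diagram.
Qed.

(** In column [c] the rows [l+1] to [r] are full, so sliding these cells down by one gives the same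
    set as moving the top one to row [l]. *)
Lemma kohnert_move_lower :
  kohnert_move (coord_diagram x) r = coord_diagram (lower x i l).
Proof.
rewrite /kohnert_move rightmost_coord_diagram row_neq0 -/l l_gt0 /=.
have xi_max j : i <= j -> j < N -> x j <= r.
  by rewrite leq_eqVlt => /orP[/eqP<-//|/i_last h /h/ltnW].
have lowcol j : i <= j -> j < N -> l < x j -> col j = c.
  move=> ij jN lj; case: (lowered_col ij jN lj) => [ki|->//].
  by rewrite /c !col_last //; lia.
apply/fsetP => p; rewrite !inE; apply/idP/coord_diagramP.
  (* Taking [m = l.+1] gives the landing cell, and [m = (x j).+1] a cell that was jumped over. *)
  have wit m : l < m -> m <= r ->
      exists2 j, j < N & (m.-1, c) = (lower x i l j, col j).
    move=> lm mr; have [j [ij jN xj cj]] := between lm mr; exists j => //.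
    by rewrite /lower ij xj lm cj subn1.
  move=> /orP[/eqP->|/andP[pn /coord_diagramP[j jN ep]]].
    by have := wit l.+1 (leqnn _) l_lt.
  have [/andP[ij lj]|low] := boolP ((i <= j) && (l < x j)); last first.
    by exists j => //; rewrite /lower (negPf low) subn0.
  have cj := lowcol j ij jN lj.
  have xjr : x j < r.
    rewrite ltn_neqAle xi_max // andbT; apply/eqP => e.
    by move: pn; rewrite ep e cj eqxx.
  by rewrite ep cj; exact: (wit (x j).+1 (leqW lj) xjr).
move=> [j jN ->]; rewrite /lower.
have [/andP[ij lj]|low] := boolP ((i <= j) && (l < x j)).
  have cj := lowcol j ij jN lj; rewrite cj subn1 !xpair_eqE eqxx !andbT.
  have [//|ne] /= := eqVneq (x j).-1 l.
  have xjr := xi_max j ij jN.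
  have [| |a [ia aN xa ca]] := @between (x j).-1; [lia|lia|].
  apply/andP; split; first by move: l_lt; lia.
  by rewrite -xa -ca mem_coord_diagram.
rewrite subn0 mem_coord_diagram // andbT; apply/orP; right.
apply/eqP => -[xj cj]; have ji := cell_inj vx jN iN xj cj.
by move: low; rewrite ji leqnn -/r l_lt.
Qed.

End Move.

(** * The Kohnert order in coordinates *)

Lemma coord_diagram_move x r : hook_coords x ->
  exists2 y, hook_coords y & kohnert_move (coord_diagram x) r = coord_diagram y
    /\ forall i, i < N -> y i <= x i.
Proof.
move=> vx; have [e|] := eqVneq (row (coord_diagram x) r) fset0.
  by exists x; rewrite // /kohnert_move e eqxx.
case/fset0Pn => -[a b]; rewrite !inE /= => /andP[/coord_diagramP[i0 i0N [-> _]]].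
move=> /eqP e0.
have hex : exists i, (i < N) && (x i == r) by exists i0; rewrite i0N e0 eqxx.
have hub i : (i < N) && (x i == r) -> i <= N by lia.
case: (ex_maxnP hex hub) => i /andP[iN /eqP <-] imax.
have ilast j : i < j -> j < N -> x j < x i.
  move=> ij jN; have := vx.1 i j ij jN; have := imax j; rewrite jN /=.
  by case: eqP; lia.
have [l0|l0] := posnP (landing_row (coord_diagram x) (x i) (col i)).
  exists x => //; split=> //.
  by rewrite /kohnert_move (rightmost_coord_diagram iN ilast) l0 andbF.
exists (lower x i (landing_row (coord_diagram x) (x i) (col i))).
  exact: hook_coords_lower.
by split; [exact: kohnert_move_lower|move=> j _; apply: leq_subr].
Qed.

Lemma kohnert_le_coord_diagram x E : hook_coords x ->
  kohnert_le E (coord_diagram x) ->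
  exists2 y, hook_coords y & E = coord_diagram y /\ forall i, i < N -> y i <= x i.
Proof.
move=> vx [s ->] {E}; elim: s x vx => [|r s IH] x vx /=; first by exists x.
have [y vy [-> yx]] := coord_diagram_move r vx.
have [z vz [-> zy]] := IH y vy; exists z => //; split=> // i iN.
exact: leq_trans (zy i iN) (yx i iN).
Qed.

(** Moves only lower coordinates; conversely, induction on the total gap reaches [x] by one-step
    moves. *)
Lemma coord_diagram_le x y : hook_coords x -> hook_coords y ->
  kohnert_le (coord_diagram x) (coord_diagram y) <->
  forall i, i < N -> x i <= y i.
Proof.
move=> vx vy; split=> [/(kohnert_le_coord_diagram vy)[z vz [e zy]] i iN|].
  by rewrite (coord_diagram_inj vx vz e iN) zy.
have [m] := ubnP (\sum_(i < N) (y i - x i)).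
elim: m y vy => // m IH y vy hm le.
have [e|] := pselect (forall i, i < N -> y i <= x i).
  have -> : coord_diagram x = coord_diagram y; last exact: kohnert_le_refl.
  by apply: eq_coord_diagram => i iN; apply/eqP; rewrite eqn_leq le ?e.
move=> ne; have hex : exists i, (i < N) && (x i < y i).
  apply: contrapT => h; apply: ne => i iN; rewrite leqNgt; apply/negP => lt.
  by apply: h; exists i; rewrite iN.
have hub i : (i < N) && (x i < y i) -> i <= N by lia.
(* Lowering the last coordinate that differs keeps the sequence above [x]. *)
case: (ex_maxnP hex hub) => i /andP[iN lti] imax.
have same j : i < j -> j < N -> y j = x j.
  move=> ij jN; have := imax j; have := le j jN; rewrite jN /=; lia.
have ilast j : i < j -> j < N -> y j < y i.
  by move=> ij jN; rewrite same //; have := vx.1 i j ij jN; lia.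
have xi0 := vx.2 i iN.
(* A cell just below in the last column would have an index [j > i], but then
   [y j = x j < x i < y i] is too low for row [y i - 1]. *)
have free : ((y i).-1, col i) \notin coord_diagram y.
  apply/coord_diagramP => -[j jN [ey /col_eq[eji|[ki kj]]]].
    by move: ey lti; rewrite -eji; lia.
  case: (ltngtP i j) => [ij|ji|eji]; last by move: ey lti; rewrite -eji; lia.
    by have := vx.1 i j ij jN; rewrite ki -same // -ey; lia.
  by have := vy.1 j i ji iN; lia.
have l1 : (y i).-1 <= landing_row (coord_diagram y) (y i) (col i).
  by apply: le_landing_row => //; lia.
have l0 : 0 < landing_row (coord_diagram y) (y i) (col i) by lia.
have [l2 _] := landing_rowP l0.
have el : landing_row (coord_diagram y) (y i) (col i) = (y i).-1 by lia.
have := hook_coords_lower vy iN ilast l0.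
have := kohnert_move_lower vy iN ilast l0; rewrite el => em vz.
(* Later cells already lie below row [y i], so only index [i] is lowered. *)
have lowE j : j < N -> lower y i (y i).-1 j = y j - (j == i).
  move=> jN; rewrite /lower; have [<-|ne'] := eqVneq j i; first by rewrite leqnn; lia.
  have [ij|//] := leqP i j; have := ilast j; rewrite jN; lia.
apply: (@kohnert_le_trans (coord_diagram (lower y i (y i).-1))).
  apply: IH => // [|j jN].
    rewrite ltnS in hm; apply: leq_trans hm.
    rewrite (bigD1 (Ordinal iN)) //= [ltnRHS](bigD1 (Ordinal iN)) //=.
    rewrite lowE // eqxx -addSn; apply: leq_add; first lia.
    by apply: leq_sum => j _; rewrite lowE //; lia.
  by rewrite lowE //; have := le j jN; have [->|] := eqVneq j i; lia.
by exists [:: y i]; rewrite /= em.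
Qed.

(** For [a < i], [x a = y a] obeys the constraint against [y i], hence against [x i + 1]. *)
Lemma hook_coords_raise x y i : hook_coords x -> hook_coords y ->
  (forall j, j < N -> x j <= y j) -> i < N -> x i < y i ->
  (forall j, j < i -> x j = y j) -> hook_coords (fun j => x j + (j == i)).
Proof.
move=> vx vy le iN lti eqi; split=> [a b ab bN|j jN]; last first.
  by have := vx.2 j jN; lia.
have := vx.1 a b ab bN; have := vy.1 a b ab bN.
have [eb|] := eqVneq b i; last lia.
have := eqi a; rewrite -eb ab => -> //; move: lti; rewrite -eb; lia.
Qed.

(** * Minimum and EL-shellability of the poset *)

Hypothesis n_gt0 : 0 < n.

(** The least coordinates: the last column fills rows [n] down to 1, and truncated subtraction puts
    every arm cell in row [n]. *)
Definition bottom_coords (i : nat) : nat := n - (i - k).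

Lemma hook_coords_bottom : hook_coords bottom_coords.
Proof.
rewrite /hook_coords /bottom_coords /N.
split=> [i j ij jN|i iN]; last by move: n_gt0; lia.
by have [ki|ik] := leqP k i; lia.
Qed.

(** Induction backwards from the last index, whose coordinate is positive. *)
Lemma bottom_coords_le x : hook_coords x ->
  forall i, i < N -> bottom_coords i <= x i.
Proof.
move=> vx i; have [d] := ubnP (N - i).
elim: d i => // d IH i hd iN; rewrite /bottom_coords.
have [iN'|lei] := ltnP i.+1 N.
  have := vx.1 i i.+1 (leqnn _) iN'; have := IH i.+1.
  rewrite /bottom_coords iN'; have [ki|ik] := leqP k i; lia.
have := vx.2 i iN; move: n_gt0 hd lei; rewrite /N; lia.
Qed.

Lemma EL_shellable_coord x0 : hook_coords x0 ->
  EL_shellable (kohnert_poset (coord_diagram x0)).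
Proof.
move=> v0; set D := coord_diagram x0.
have coords (E : kohnert_poset D) :
    exists x, hook_coords x /\ val E = coord_diagram x.
  have /asboolP := valP E; move=> /(kohnert_le_coord_diagram v0)[y vy [-> _]].
  by exists y.
(* Values from index [N] on are not determined by the diagram, so a sequence is chosen for each
   element. *)
have [f hf] := choice coords.
have leP (E F : kohnert_poset D) :
    (E <= F)%O <-> forall i, i < N -> f E i <= f F i.
  have [vE eE] := hf E; have [vF eF] := hf F.
  rewrite -(coord_diagram_le vE vF) -eE -eF.
  by split=> [/asboolP|h]; [|apply/asboolP].
(* Every valid sequence below [x0] is realised in the poset, and by injectivity the chosen
   coordinates agree with it below [N]. *)
have mk x : hook_coords x -> (forall i, i < N -> x i <= x0 i) ->
    exists E : kohnert_poset D, forall i, i < N -> f E i = x i.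
  move=> vx lex; have xD : `[< KD D (coord_diagram x) >].
    by apply/asboolP/(coord_diagram_le vx v0).
  pose E : kohnert_poset D := exist _ (coord_diagram x) xD.
  by exists E; have [vE eE] := hf E; exact: coord_diagram_inj (esym eE).
have [top htop] := mk x0 v0 (fun i _ => leqnn _).
have le_top E : forall i, i < N -> f E i <= x0 i.
  have [vE eE] := hf E; apply/(coord_diagram_le vE v0).
  by rewrite -eE; have /asboolP := valP E.
split.
  have [bot hbot] := mk _ hook_coords_bottom (bottom_coords_le v0).
  exists bot, top => E; have [vE _] := hf E.
  by apply/andP; split; apply/leP => i iN;
     rewrite ?hbot ?htop ?bottom_coords_le ?le_top.
exists _, nat, (fun E F => find (fun i => f E i < f F i) (iota 0 N)).
apply: EL_labeling_coord => // E F i EF iN lti eqi.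
have [vE _] := hf E; have [vF _] := hf F.
have leEF := (leP E F).1 EF.
have [|j jN|G hG] := mk (fun j => f E j + (j == i)).
- exact: hook_coords_raise vE vF leEF iN lti eqi.
- have := le_top F j jN; have := leEF j jN.
  by have [->|] := eqVneq j i; lia.
by exists G.
Qed.

End HookCoordinates.

(** * Coordinates of the initial hook *)

Lemma hook_coord_diagram r1 r2 (C : {fset nat}) :
  0 < r1 -> r1 <= r2 -> C != fset0 ->
  exists k n col x, [/\ 0 < n, forall i j, i < j -> j <= k -> col i < col j,
    forall i, k <= i -> col i = col k, hook_coords k n x
    & hook r1 r2 C = coord_diagram k n col x].
Proof.
move=> r1_gt0 r12 Cn0; set s := sort leq C.
have ms c : (c \in s) = (c \in C) by rewrite mem_sort.
have ltn_s : sorted ltn s.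
  by rewrite ltn_sorted_uniq_leq sort_uniq fset_uniq sort_sorted //; exact: leq_total.
have s_gt0 : 0 < size s by rewrite size_sort cardfs_gt0.
set k := (size s).-1; have ks : k < size s by rewrite /k; lia.
(* Clamping at [k] makes every index from [k] on name the last column. *)
pose col i := nth 0 s (minn i k).
have col_lt i j : i < j -> j <= k -> col i < col j.
  move=> ij jk; rewrite /col !(minn_idPl _) ?(ltnW (leq_trans ij jk)) //.
  by rewrite (sorted_ltn_nth ltn_trans) // inE; lia.
have col_last i : k <= i -> col i = col k.
  by move=> ki; rewrite /col (minn_idPr ki) minnn.
have colP c : c \in C -> exists2 i, i <= k & c = col i.
  rewrite -ms => cs; have ci : index c s < size s by rewrite index_mem.
  exists (index c s); first by rewrite /k; lia.
  by rewrite /col (minn_idPl _) ?nth_index //; rewrite /k; lia.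
have col_in i : col i \in C.
  by rewrite -ms mem_nth // (leq_ltn_trans _ ks) // geq_minr.
have maxC : \max_(c <- C) c = col k.
  apply/eqP; rewrite eqn_leq; apply/andP; split; last first.
    by apply: (@leq_bigmax_seq _ _ predT id).
  apply/bigmax_leqP_seq => c /colP[i ik ->] _.
  by move: ik; rewrite leq_eqVlt => /orP[/eqP->//|/col_lt h]; rewrite ltnW ?h.
(* Truncated subtraction puts the arm in row [r2]; index [k + t] then lies in row [r2 - t], down to
   [r1]. *)
exists k, (r2 - r1).+1, col, (fun i => r2 - (i - k)); split=> //.
  split=> [i j ij jN|i iN]; last by lia.
  by have [ki|ik] := leqP k i; lia.
apply/fsetP => -[a b]; rewrite /hook maxC inE; apply/orP/coord_diagramP.
  case=> /imfsetP[j /= hj [-> ->]].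
    have [i ik ->] := colP j hj; exists i; first lia.
    by congr (_, _); lia.
  move: hj; rewrite mem_index_iota => hj.
  exists (k + (r2 - j)); first lia.
  by rewrite col_last ?leq_addr //; congr (_, _); lia.
move=> [i iN [-> ->]]; have [ki|ik] := leqP k i.
  right; apply/imfsetP; exists (r2 - (i - k)).
    by rewrite /= mem_index_iota; lia.
  by rewrite col_last.
left; apply/imfsetP; exists (col i); first exact: col_in.
by congr (_, _); lia.
Qed.

Theorem theorem4p11 (D : cells) (hD : hook_diagram D) :
  EL_shellable (kohnert_poset D).
Proof.
have [_ [r1 [r2 [C [r1_gt0 r12 Cn0 _ DH]]]]] := hD.
have [k [n [col [x [n_gt0 col_lt col_last vx eH]]]]] :=
  hook_coord_diagram r1_gt0 r12 Cn0.
move: DH; rewrite /KD eH.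
(* Every diagram reached from the hook, [D] included, has coordinates with the same [k], [n] and
   [col]. *)
move=> /(kohnert_le_coord_diagram col_lt col_last vx)[y vy [-> _]].
exact: EL_shellable_coord.
Qed.
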